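(* Let $n_0$ be an integer and let $\boldsymbol\alpha=(\alpha(n))_{n\ge n_0}$ be a strictly increasing sequence of integers $\ge n_0$ such that the set of integers $\ge n_0$ not in $\boldsymbol\alpha$ is infinite. Then there exists a unique strictly increasing sequence $\boldsymbol\beta=(\beta(n))_{n\ge n_0}$ of integers $\ge n_0$, whose complement in $\{n_0,n_0+1,\dots\}$ is infinite, such that the Aronson transform of $\boldsymbol\beta$ equals $\boldsymbol\alpha$ (the inverse Aronson transform of $\boldsymbol\alpha$ exists and is unique).
   Context: For $n_0$ an integer and $\boldsymbol\beta=(\beta(n))_{n\ge n_0}$ a strictly increasing sequence of integers $\ge n_0$ whose complement in $\{n_0,n_0+1,\dots\}$ is infinite, the Aronson transform of $\boldsymbol\beta$ is the sequence $\boldsymbol\alpha=(\alpha(n))_{n\ge n_0}$ defined greedily: $\alpha(n)$ is the smallest integer $\ge n_0$ and greater than $\alpha(n-1)$ that is consistent with (i.e. admits an infinite strictly increasing continuation satisfying) the condition ''for every $m\ge n_0$, $m$ is a term of $\boldsymbol\alpha$ if and only if $\alpha(m)$ is a term of $\boldsymbol\beta$''; equivalently, it is the lexicographically least strictly increasing sequence of integers $\ge n_0$ satisfying this condition. *)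

(* Defs.v *)
From mathcomp Require Import all_boot all_order all_algebra.
From mathcomp Require Import boolp classical_sets functions cardinality.
Set Implicit Arguments.
Unset Strict Implicit.
Unset Printing Implicit Defensive.
Import Order.TTheory GRing.Theory Num.Theory.
Local Open Scope classical_set_scope.
Local Open Scope ring_scope.

(* A sequence (a(n))_{n >= n0} is a function a : int -> int of which only the
   values at n >= n0 are meaningful; equality of sequences is eq_from n0. *)

Definition eq_from (n0 : int) (a b : int -> int) : Prop :=
  forall n, n0 <= n -> a n = b n.

Definition increasing_from (n0 : int) (a : int -> int) : Prop :=
  (forall n, n0 <= n -> n0 <= a n) /\
  (forall m n, n0 <= m -> m < n -> a m < a n).

Definition terms (n0 : int) (a : int -> int) : set int :=
  a @` [set n | n0 <= n].

Definition coinfinite (n0 : int) (a : int -> int) : Prop :=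
  infinite_set ([set m | n0 <= m] `\` terms n0 a).

Definition aronson_condition (n0 : int) (b a : int -> int) : Prop :=
  forall m, n0 <= m -> (terms n0 a m <-> terms n0 b (a m)).

(* The value k is possible for the n-th term, once the terms of index < n have
   been chosen to be those of a. *)
Definition consistent (n0 : int) (b a : int -> int) (n k : int) : Prop :=
  exists c : int -> int,
    [/\ increasing_from n0 c,
        aronson_condition n0 b c,
        forall m, n0 <= m -> m < n -> c m = a m
      & c n = k].

Definition greedy_candidate (n0 : int) (b a : int -> int) (n k : int) : Prop :=
  [/\ n0 <= k, n0 < n -> a (n - 1) < k & consistent n0 b a n k].

(* The sequence a is the Aronson transform of b; this determines a from b, by
   aronson_transform_unique. *)
Definition aronson_transform (n0 : int) (b a : int -> int) : Prop :=
  forall n, n0 <= n ->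
    greedy_candidate n0 b a n (a n) /\
    forall k, greedy_candidate n0 b a n k -> a n <= k.

Lemma aronson_transform_unique (n0 : int) (b a a' : int -> int) :
  aronson_transform n0 b a -> aronson_transform n0 b a' -> eq_from n0 a a'.
Proof.
move=> ha ha'.
have cand u v n k : (forall m, n0 <= m -> m < n -> u m = v m) ->
    greedy_candidate n0 b u n k -> greedy_candidate n0 b v n k.
  move=> uv [k0 kn [c [ci ca cu cn]]]; split => //.
    by move=> n0n; rewrite -uv ?kn// ?lerBrDr ?lezD1// ltrBlDr ltrDl.
  by exists c; split => // m m0 mn; rewrite cu ?uv.
have H (i : nat) m : n0 <= m -> m < n0 + i%:Z -> a m = a' m.
  elim: i m => [|i IH] m m0.
    by rewrite addr0 ltNge m0.
  rewrite -addn1 PoszD addrA ltzD1 => mi.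
  have E k : n0 <= k -> k < m -> a k = a' k.
    by move=> k0 km; apply: IH => //; exact: lt_le_trans mi.
  have [c l] := ha _ m0; have [c' l'] := ha' _ m0.
  apply/le_anti/andP; split.
    by apply: l; apply: cand c' => k k0 km; rewrite E.
  by apply: l'; apply: cand c.
move=> n n0n; apply: (H (`|n - n0|%N.+1)) => //.
by rewrite -addn1 PoszD gez0_abs ?subr_ge0// addrA subrKC ltzD1.
Qed.

(* Main.v *)
Require Import Defs.
From mathcomp Require Import all_boot all_order all_algebra.
From mathcomp Require Import boolp classical_sets functions cardinality.
From mathcomp Require Import zify.
Import Order.TTheory GRing.Theory Num.Theory.
Local Open Scope ring_scope.

Set Implicit Arguments.
Unset Strict Implicit.
Unset Printing Implicit Defensive.
Local Open Scope classical_set_scope.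

(* Let n be the index of the gap of a containing v, that is, the least n with
   v <= a n. If v = a n, the Aronson condition at n says that v is a term of b
   iff n is a term of a. If v < a n, greediness says that v cannot be the n-th
   term of a sequence starting like a. Such a sequence takes the value n iff a
   does or v = n, and once the condition holds up to n it can always be
   continued; so v must be a term of b iff n is not a term of a and v <> n.
   These two rules decide membership in b for every v, which gives uniqueness,
   and the set they define is infinite and coinfinite: it contains a m exactly
   when m is a term of a. *)

(** * Recursion and unbounded sets of integers *)

Lemma int_from_ind (n0 : int) (P : int -> Prop) :
  P n0 -> (forall n, n0 <= n -> P n -> P (n + 1)) ->
  forall n, n0 <= n -> P n.
Proof.
move=> P0 PS n n0n; have -> : n = n0 + `|n - n0|%N%:Z by lia.
elim: `|n - n0|%N => [|i IH]; first by rewrite addr0.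
by rewrite (_ : n0 + _ = n0 + i%:Z + 1); [apply: PS; [lia|]|lia].
Qed.

(** [L i] is the list of the first [i] values, extended at each stage by [F] of itself. *)
Lemma course_of_values (T : Type) (F : seq T -> T) :
  exists c : nat -> T, forall i, c i = F (mkseq c i).
Proof.
pose L i := iter i (fun s => rcons s (F s)) [::].
exists (F \o L) => i /=; congr F.
by elim: i => [//|i IH]; rewrite mkseqS -IH.
Qed.

Lemma unbounded_infinite (A : set int) :
  (forall N, exists2 x, A x & N < x) -> infinite_set A.
Proof.
move=> unb /finite_seqP[s eA].
have [x Ax] := unb (\big[Num.max/0]_(y <- s) y).
rewrite ltNge => /negP; apply.
by apply: le_bigmax_seq => //; move: Ax; rewrite eA.
Qed.

Lemma infinite_unbounded (n0 : int) (A : set int) :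
  (forall x, A x -> n0 <= x) -> infinite_set A ->
  forall N, exists2 x, A x & N < x.
Proof.
move=> A0 infA N; apply: contrapT => noA; apply: infA.
apply: (@sub_finite_set _ _ ((fun i : nat => n0 + i%:Z) @` `I_(`|N - n0|.+1))).
  move=> x Ax; exists `|x - n0|%N; last by have := A0 _ Ax; lia.
  have xN : x <= N by rewrite leNgt; apply/negP => Nx; apply: noA; exists x.
  by rewrite /=; have := A0 _ Ax; lia.
exact/finite_image/finite_II.
Qed.

(** * Increasing sequences and their sets of terms *)

Lemma increasing_lt (n0 : int) (a : int -> int) m n :
  increasing_from n0 a -> n0 <= m -> n0 <= n -> (a m < a n) = (m < n).
Proof.
move=> ha m0 n1; case: (ltgtP m n) => [mn|nm|->]; last by rewrite ltxx.
  by apply: ha.2.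
by apply/negbTE; rewrite -leNgt ltW//; apply: ha.2.
Qed.

Lemma increasing_ge (n0 : int) (a : int -> int) n :
  increasing_from n0 a -> n0 <= n -> n <= a n.
Proof.
move=> ha; move: n; apply: int_from_ind => [|n n0n IH]; first exact: ha.1.
by have := ha.2 n (n + 1) n0n; lia.
Qed.

Lemma terms_ge (n0 : int) (a : int -> int) x :
  increasing_from n0 a -> terms n0 a x -> n0 <= x.
Proof. by move=> ha [j j0 <-]; apply: ha.1. Qed.

Lemma terms_unbounded (n0 : int) (a : int -> int) (N : int) :
  increasing_from n0 a -> exists2 x, terms n0 a x & N < x.
Proof.
move=> ha; pose m := n0 + `|(N + 1 - n0)%R|%N%:Z; have m0 : n0 <= m by lia.
exists (a m); first by exists m.
by have := increasing_ge ha m0; lia.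
Qed.

(** As [j <= a j], the terms of index at most [n] already decide whether [n] occurs; sequences that
    agree up to [n] can thus be compared there. *)
Lemma terms_at (n0 : int) (a : int -> int) n :
  increasing_from n0 a -> terms n0 a n <-> exists j, [/\ n0 <= j, j <= n & a j = n].
Proof.
move=> ha; split=> [[j j0 ajn]|[j [j0 _ ajn]]]; last by exists j.
by exists j; split=> //; rewrite -ajn; apply: (increasing_ge ha).
Qed.

Lemma eq_terms_eq_from (n0 : int) (a b : int -> int) :
  increasing_from n0 a -> increasing_from n0 b ->
  (forall x, terms n0 a x <-> terms n0 b x) -> eq_from n0 a b.
Proof.
move=> ha hb ab.
suff H n : n0 <= n -> forall m, n0 <= m -> m <= n -> a m = b m.
  by move=> n n0n; apply: (H n).
have key (u v : int -> int) m : increasing_from n0 u -> increasing_from n0 v ->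
    (forall x, terms n0 u x -> terms n0 v x) -> n0 <= m ->
    (forall j, n0 <= j -> j < m -> u j = v j) -> v m <= u m.
  (* If [u m < v m], the value [u m] occurs in [v] at an index below [m], where [u] and [v] agree,
     so [u] would repeat it. *)
  move=> hu hv uv m0 E; rewrite leNgt; apply/negP => uvm.
  have [j j0 vj] : terms n0 v (u m) by apply: uv; exists m.
  have jm : j < m by rewrite -(increasing_lt hv)// vj.
  by have := hu.2 _ _ j0 jm; rewrite E// vj ltxx.
have step m : n0 <= m -> (forall j, n0 <= j -> j < m -> a j = b j) -> a m = b m.
  move=> m0 E; apply/le_anti/andP; split; apply: key => // x; try by move/ab.
  by move=> x0 xm; rewrite E.
move: n; apply: int_from_ind => [|n n0n IH] m m0 mn; apply: step => // j j0 jm; first lia.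
by apply: IH => //; lia.
Qed.

Lemma enumerate_terms (n0 : int) (A : set int) :
  (forall x, A x -> n0 <= x) -> (forall N, exists2 x, A x & N < x) ->
  exists2 b, increasing_from n0 b & forall x, terms n0 b x <-> A x.
Proof.
move=> A0 unb.
have nextP (N : int) : exists x, [/\ A x, N < x & forall y, A y -> N < y -> x <= y].
  have [x Ax Nx] := unb N.
  have ex : exists i : nat, `[< A (N + 1 + i%:Z) >].
    by exists `|(x - N - 1)%R|%N; apply/asboolP; rewrite (_ : _ + _ = x)//; lia.
  case: (ex_minnP ex) => i /asboolP Ai mini; exists (N + 1 + i%:Z); split=> //.
    lia.
  move=> y Ay Ny; have := mini `|(y - N - 1)%R|%N.
  rewrite (_ : N + 1 + `|(y - N - 1)%R|%N%:Z = y); last lia.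
  by move/(_ (asboolT Ay)); lia.
have [next nextE] := choice nextP.
(* Starting from [n0 - 1] makes the first value the least element of [A]. *)
pose f i := iter i next (next (n0 - 1)).
pose b (n : int) := f `|n - n0|%N.
have bS n : n0 <= n -> b (n + 1) = next (b n).
  by move=> n0n; rewrite /b (_ : `|(n + 1 - n0)%R|%N = `|n - n0|.+1)//; lia.
have b0 : b n0 = next (n0 - 1) by rewrite /b subrr.
have Ab n : n0 <= n -> A (b n).
  move: n; apply: int_from_ind => [|n n0n _]; first by rewrite b0; case: (nextE (n0 - 1)).
  by rewrite bS//; case: (nextE (b n)).
have hb : increasing_from n0 b.
  split=> [n n0n|m n m0 mn]; first exact/A0/Ab.
  have {mn} : m + 1 <= n by lia.
  move: n; apply: int_from_ind => [|n mn IH]; first by rewrite bS//; case: (nextE (b m)).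
  by apply: lt_trans IH _; rewrite bS; [case: (nextE (b n))|lia].
exists b => // x; split=> [[n /= n0n <-]|Ax]; first exact: Ab.
(* A skipped element [x] would stay above every [b n], because [next] never jumps over an element of
   [A]; but [x <= b x]. *)
apply: contrapT => nx.
have lt n : n0 <= n -> b n < x.
  have ne n' : n0 <= n' -> b n' <> x by move=> n0n E; apply: nx; exists n'.
  move: n; apply: int_from_ind => [|n n0n IH].
    rewrite lt_neqAle; apply/andP; split; first by apply/eqP/ne.
    by rewrite b0; case: (nextE (n0 - 1)) => _ _; apply => //; have := A0 _ Ax; lia.
  rewrite lt_neqAle; apply/andP; split; first by apply/eqP/ne; lia.
  by rewrite bS//; case: (nextE (b n)) => _ _; apply.
by have := lt x (A0 _ Ax); have := increasing_ge hb (A0 _ Ax); lia.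
Qed.

(** * Gaps of [a], and replacing a term within its gap *)

Definition gap_index (n0 : int) (a : int -> int) (n v : int) : Prop :=
  [/\ n0 <= n, n0 <= v, n0 < n -> a (n - 1) < v & v <= a n].

Definition inverse_term (n0 : int) (a : int -> int) (n v : int) : Prop :=
  if v == a n then terms n0 a n else ~ (terms n0 a n \/ v = n).

Lemma gap_index_exists (n0 : int) (a : int -> int) v :
  increasing_from n0 a -> n0 <= v -> exists n, gap_index n0 a n v.
Proof.
move=> ha v0; have ex : exists i : nat, v <= a (n0 + i%:Z).
  exists `|v - n0|%N; rewrite (_ : _ + _ = v); last lia.
  exact: (increasing_ge ha).
case: (ex_minnP ex) => i vi mini; exists (n0 + i%:Z); split=> //; first lia.
(* Minimality of [i] gives the lower bound; the first gap is bounded below by [n0] alone, since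
   [a (n0 - 1)] is meaningless. *)
move=> i0; rewrite ltNge; apply/negP.
rewrite (_ : n0 + i%:Z - 1 = n0 + i.-1%:Z); last lia.
by move/mini; lia.
Qed.

Lemma gap_index_before (n0 : int) (a : int -> int) n v m :
  increasing_from n0 a -> gap_index n0 a n v -> n0 <= m -> m < n -> a m < v.
Proof.
move=> ha [n0n v0 nv vn] m0 mn; have {nv} := nv (le_lt_trans m0 mn).
apply: le_lt_trans; have [->//|mn1] := eqVneq m (n - 1).
by apply/ltW/ha.2 => //; lia.
Qed.

Lemma gap_index_unique (n0 : int) (a : int -> int) v n n' :
  increasing_from n0 a -> gap_index n0 a n v -> gap_index n0 a n' v -> n = n'.
Proof.
move=> ha gn gn'; case: (gn) (gn') => [n1 _ _ vn] [n1' _ _ vn'].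
case: (ltgtP n n') => // [nn|nn].
  by have := gap_index_before ha gn' n1 nn; lia.
by have := gap_index_before ha gn n1' nn; lia.
Qed.

Lemma gap_index_term (n0 : int) (a : int -> int) n :
  increasing_from n0 a -> n0 <= n -> gap_index n0 a n (a n).
Proof.
by move=> ha n0n; split=> //; [apply: ha.1|move=> nn; apply: ha.2; lia].
Qed.

(* Beyond index n, the term of index p is chosen larger than p, so whether p
   occurs is already decided by the earlier terms; it can then be put inside or
   outside b as required since b is infinite and coinfinite. *)
Lemma consistent_below_gap (n0 : int) (a b : int -> int) n k :
  increasing_from n0 a -> increasing_from n0 b -> coinfinite n0 b ->
  gap_index n0 a n k -> k < a n ->
  (forall m, n0 <= m -> m < n -> (terms n0 a m <-> terms n0 b (a m))) ->
  (terms n0 b k <-> terms n0 a n \/ k = n) ->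
  consistent n0 b a n k.
Proof.
move=> ha hb cb gk kn ab bk; have [n0n k0 nk _] := gk.
have unbC N : exists2 x, ~ terms n0 b x & N < x.
  by have [x [_ bx] Nx] := infinite_unbounded (fun _ => @proj1 _ _) cb N; exists x.
(* With [s] the list of terms chosen so far, [n0 + size s] is the index of the next one. The default
   [n0] of [last] is harmless, as [pick] serves only indices above [n], where [s] is nonempty. *)
have pickP (s : seq int) : exists x, [/\ last n0 s < x, n0 + (size s)%:Z < x &
    terms n0 b x <-> (n0 + (size s)%:Z) \in s].
  pose N := Num.max (last n0 s) (n0 + (size s)%:Z).
  have [ins|nins] := boolP (n0 + (size s)%:Z \in s).
    by have [x bx Nx] := terms_unbounded N hb; exists x; split => //; lia.
  by have [x bx Nx] := unbC N; exists x; split => //; lia.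
have [pick pickE] := choice pickP.
pose F s := let p := n0 + (size s)%:Z in
  if p < n then a p else if p == n then k else pick s.
have [f fE] := course_of_values F.
pose c (m : int) := f `|m - n0|%N.
have c_lt m : n0 <= m -> m < n -> c m = a m.
  move=> m0 mn; rewrite /c fE /F size_mkseq /= (_ : _ + _ = m); last lia.
  by rewrite mn.
have cn : c n = k.
  by rewrite /c fE /F size_mkseq /= (_ : _ + _ = n) ?ltxx ?eqxx//; lia.
have c_gt m : n < m -> [/\ c (m - 1) < c m, m < c m &
    terms n0 b (c m) <-> exists j, [/\ n0 <= j, j < m & c j = m]].
  move=> nm; set s := mkseq f `|m - n0|%N.
  have szs : n0 + (size s)%:Z = m by rewrite size_mkseq; lia.
  have cmE : c m = pick s.
    rewrite /c fE -/s /F /= szs ifF; last lia.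
    by rewrite ifF//; lia.
  have lasts : last n0 s = c (m - 1).
    rewrite /s (_ : `|m - n0|%N = `|(m - 1 - n0)%R|.+1)%N; last lia.
    by rewrite mkseqS last_rcons.
  have [p1 p2 p3] := pickE s; rewrite szs in p2 p3.
  rewrite cmE -lasts; split=> //; rewrite p3; split.
    move=> /mapP[i]; rewrite mem_iota => ilt mE; exists (n0 + i%:Z).
    split; [lia|lia|]; rewrite mE /c; congr f; lia.
  move=> [j [j0 jm cj]]; apply/mapP; exists `|j - n0|%N => //.
  by rewrite mem_iota; lia.
have cS m : n0 <= m -> c m < c (m + 1).
  move=> m0; case: (ltgtP (m + 1) n) => mn.
  - by rewrite !c_lt//; [apply: ha.2|..]; lia.
  - by have [] := c_gt _ mn; rewrite addrK.
  - by rewrite mn cn c_lt//; [apply: (gap_index_before ha gk)|]; lia.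
have hc : increasing_from n0 c.
  have inc m m' : n0 <= m -> m < m' -> c m < c m'.
    move=> m0 mm; have {mm} : m + 1 <= m' by lia.
    move: m'; apply: int_from_ind => [|m' mm' IH]; first exact: cS.
    by apply: lt_trans IH _; apply: cS; lia.
  split=> // m m0; have cn0 : n0 <= c n0.
    have [n0n'|] := ltP n0 n; first by rewrite c_lt//; apply: ha.1.
    by move=> nn0; rewrite (_ : n0 = n) ?cn; lia.
  have [->//|mn0] := eqVneq m n0.
  by apply: le_trans cn0 (ltW _); apply: inc => //; lia.
exists c; split=> // m m0; rewrite (terms_at _ hc).
case: (ltgtP m n) => mn.
- rewrite c_lt// -ab// (terms_at _ ha).
  by split=> -[j [j0 jm cj]]; exists j; split=> //; rewrite -?cj ?c_lt//; lia.
(* The choice of [c m] inspected only indices below [m]; index [m] adds nothing since [m < c m]. *)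
- have [_ mc ->] := c_gt _ mn.
  split=> -[j [j0 jm cj]]; exists j; split=> //; last lia.
  by rewrite lt_neqAle jm andbT; apply/eqP => jE; move: mc; rewrite -jE cj; lia.
- rewrite mn cn bk (terms_at _ ha); split.
    move=> [j [j0 jn cj]]; have [jE|jn'] := eqVneq j n.
      by right; rewrite -cn -{1}jE.
    by left; exists j; split=> //; rewrite -c_lt//; lia.
  move=> [[j [j0 jn aj]]|kE]; last by exists n; rewrite cn.
  (* Here [j = n] is impossible: it would give [a n = n <= k < a n]. *)
  have nk' : n <= k by rewrite -cn; apply: (increasing_ge hc).
  exists j; split=> //; rewrite c_lt//.
  by rewrite lt_neqAle jn andbT; apply/eqP => jE; move: aj; rewrite jE; lia.
Qed.

(** * The transform as a membership rule on each gap *)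

Lemma aronson_transformP (n0 : int) (a b : int -> int) :
  increasing_from n0 a -> increasing_from n0 b -> coinfinite n0 b ->
  aronson_transform n0 b a <->
  forall n v, gap_index n0 a n v -> (terms n0 b v <-> inverse_term n0 a n v).
Proof.
move=> ha hb cb; split=> [tr|H].
  have ab m : n0 <= m -> (terms n0 a m <-> terms n0 b (a m)).
    (* The witness [c] for the [m]-th term agrees with [a] through index [m], so its condition at
       [m] carries over to [a]. *)
    move=> m0; have [[_ _ [c [hc ac cE cm]]] _] := tr _ m0.
    have {}cE j : n0 <= j -> j <= m -> c j = a j.
      by move=> j0 jm; have [->//|jm'] := eqVneq j m; apply: cE => //; lia.
    rewrite -cm -ac// (terms_at _ ha) (terms_at _ hc).
    by split=> -[j [j0 jm E]]; exists j; split=> //; rewrite -E cE.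
  move=> n v gv; have [n0n v0 nv vn] := gv.
  rewrite /inverse_term; case: eqP => [->|/eqP vne]; first by rewrite ab.
  have {}vn : v < a n by rewrite lt_neqAle vne.
  have [//|nH] := pselect (terms n0 b v <-> ~ (terms n0 a n \/ v = n)).
  (* Were the rule to fail, [v] would be a candidate below the least one, [a n]. *)
  suff cv : consistent n0 b a n v.
    by have [_ /(_ v)] := tr _ n0n; move/(_ (And3 v0 nv cv)); lia.
  apply: consistent_below_gap => //; first by move=> m m0 _; apply: ab.
  by have [] := pselect (terms n0 b v); have [] := pselect (terms n0 a n \/ v = n);
    tauto.
have ab : aronson_condition n0 b a.
  move=> m m0; have := H _ _ (gap_index_term ha m0).
  by rewrite /inverse_term eqxx => ->.
move=> n n0n; split.
  split; [exact: ha.1|by move=> nn; apply: ha.2; lia|by exists a].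
(* A candidate [k < a n] lies in the gap of index [n], where the rule contradicts the condition of
   [c] at [n]. *)
move=> k [k0 nk [c [hc ac cE cn]]]; rewrite leNgt; apply/negP => kn.
have := H n k (And4 n0n k0 nk (ltW kn)).
rewrite /inverse_term lt_eqF// -cn -ac// cn.
have nk' : n <= k by rewrite -cn; apply: (increasing_ge hc).
rewrite (terms_at _ ha) (terms_at _ hc).
have [kE|kne] := eqVneq k n.
  (* Now [c n = n], so the condition puts [k] in [b], while the rule excludes the value [n]. *)
  move=> [+ _] => /(_ _)[]; last by right.
  by exists n; rewrite cn kE.
(* k > n, so neither c nor a takes the value n at index n or later. *)
suff -> : (exists j, [/\ n0 <= j, j <= n & c j = n]) <->
          (exists j, [/\ n0 <= j, j <= n & a j = n]).
  by move: kne => /eqP; tauto.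
split=> -[j [j0 jn E]]; exists j; split=> //.
  by rewrite -cE//; have [jE|] := eqVneq j n; [move: E; rewrite jE cn|]; lia.
by rewrite cE//; have [jE|] := eqVneq j n; [move: E; rewrite jE|]; lia.
Qed.

Theorem theorem3 (n0 : int) (a : int -> int)
    (ha : increasing_from n0 a) (hac : coinfinite n0 a) :
  exists b : int -> int,
    [/\ increasing_from n0 b, coinfinite n0 b & aronson_transform n0 b a] /\
    forall b' : int -> int,
      [/\ increasing_from n0 b', coinfinite n0 b' & aronson_transform n0 b' a] ->
      eq_from n0 b b'.
Proof.
pose B : set int := fun v => exists2 n, gap_index n0 a n v & inverse_term n0 a n v.
have BE n v : gap_index n0 a n v -> (B v <-> inverse_term n0 a n v).
  move=> gv; split=> [[n' gv']|]; last by exists n.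
  by rewrite (gap_index_unique ha gv gv').
have Ba m : n0 <= m -> (B (a m) <-> terms n0 a m).
  by move=> m0; rewrite (BE _ _ (gap_index_term ha m0)) /inverse_term eqxx.
have [||b hb bB] := @enumerate_terms n0 B.
- by move=> v [n []].
- move=> N; have [m tm Nm] := terms_unbounded N ha.
  have m0 := terms_ge ha tm; exists (a m); first exact/Ba.
  by apply: lt_le_trans Nm _; apply: (increasing_ge ha).
have cb : coinfinite n0 b.
  (* Each [x] missing from [a] yields [a x] missing from [b], and [x <= a x]. *)
  apply: unbounded_infinite => N.
  have [x [/= x0 xa] Nx] := infinite_unbounded (fun _ => @proj1 _ _) hac N.
  exists (a x); last by apply: lt_le_trans Nx _; apply: (increasing_ge ha).
  by split; [apply: ha.1|rewrite bB Ba].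
exists b; split.
  by split=> //; apply/aronson_transformP => // n v /BE <-.
(* Every [v >= n0] lies in some gap, whose rule decides membership in [b] and [b'] alike. *)
move=> b' [hb' cb' tr']; apply: eq_terms_eq_from => // v.
have E := (aronson_transformP ha hb' cb').1 tr'.
split=> tv.
  have [n gv] := gap_index_exists ha (terms_ge hb tv).
  by apply/(E _ _ gv)/BE => //; apply/bB.
have [n gv] := gap_index_exists ha (terms_ge hb' tv).
by apply/bB/(BE _ _ gv)/E.
Qed.
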